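(* Let $P$ be a finite poset with $|P|\ge2$ whose Hasse diagram is connected. Then $X_P\dashrightarrow U_P$ is crepant if and only if $P$ is bounded, i.e. $P$ has both a minimum element and a maximum element.
   Context: Identify $P$ with $[n]$; $N=\mathbb{Z}^n/\mathbb{Z}(1,\dots,1)$, $N_{\mathbb{R}}=N\otimes\mathbb{R}$, $M$ the dual lattice. The braid cone is $\sigma_P=\{x\in N_{\mathbb{R}}: x_i\le x_j\text{ whenever } i<_P j\}$ and $U_P$ its affine toric variety. $\Sigma_P$ is the fan consisting of the cones $\sigma_L$ for all linear extensions $L$ of $P$ (Weyl chambers of the braid arrangement) together with their faces; it is a smooth fan refining $\sigma_P$, and $X_P$ is its toric variety. $X_P\dashrightarrow U_P$ is called crepant if $U_P$ is $\mathbb{Q}$-Gorenstein of some index $r$ (the least positive integer $r$ such that some $u\in M$ has $\langle u,v\rangle=r$ for all ray generators $v$ of $\sigma_P$) and for such $u$ also $\langle u,v\rangle=r$ for every ray generator $v$ of $\Sigma_P$. *)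

(* Defs.v *)
From HB Require Import structures.
From mathcomp Require Import all_boot all_order all_algebra.
From mathcomp Require Import mathcomp_extra boolp classical_sets reals.

Set Implicit Arguments.
Unset Strict Implicit.
Unset Printing Implicit Defensive.

Import Order.TTheory GRing.Theory Num.Theory.
Local Open Scope classical_set_scope.
Local Open Scope quotient_scope.
Local Open Scope ring_scope.

(** * Coordinate vectors modulo the diagonal *)

Section Diagonal.
Variables (P : finType) (K : nzRingType).

Definition diagonal : {pred {ffun P -> K}} :=
  fun x => [forall i, forall j, x i == x j].

Lemma diagonalP (x : {ffun P -> K}) :
  reflect (forall i j, x i = x j) (x \in diagonal).
Proof.
apply: (iffP forallP) => [h i j|h i]; first by apply/eqP/(forallP (h i)).
by apply/forallP => j; rewrite (h i j).
Qed.

(* The decidable test above does describe the submodule spanned by (1,..,1). *)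
Lemma diagonal_span (x : {ffun P -> K}) :
  x \in diagonal <-> exists c : K, x = [ffun=> c].
Proof.
split=> [/diagonalP h|[c ->]]; last by apply/diagonalP => i j; rewrite !ffunE.
have [i _|P0] := pickP (@predT P).
  by exists (x i); apply/ffunP => j; rewrite ffunE.
by exists 0; apply/ffunP => i; have := P0 i.
Qed.

Lemma diagonal_zmod_closed : zmod_closed diagonal.
Proof.
split=> [|x y /diagonalP hx /diagonalP hy].
  by apply/diagonalP => i j; rewrite !ffunE.
by apply/diagonalP => i j; rewrite !ffunE (hx i j) (hy i j).
Qed.

HB.instance Definition _ :=
  GRing.isZmodClosed.Build {ffun P -> K} diagonal diagonal_zmod_closed.

End Diagonal.

(* K^P / K(1,..,1). *)
Definition qspace (P : finType) (K : nzRingType) : Type :=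
  Quotient.quot (@diagonal P K : zmodClosed {ffun P -> K}).

HB.instance Definition _ (P : finType) (K : nzRingType) :=
  GRing.Zmodule.on (qspace P K).

Section QSpace.
Variables (P : finType) (K : nzRingType).
Local Notation V := (qspace P K).

Definition class_of (x : {ffun P -> K}) : V := \pi_V x.
Definition rep (v : V) : {ffun P -> K} := repr v.

Lemma repK : cancel rep class_of.
Proof. by move=> v; rewrite /class_of /rep reprK. Qed.

Lemma eq_class (x y : {ffun P -> K}) :
  class_of x = class_of y <-> forall i j, x i - y i = x j - y j.
Proof.
have E : (class_of x == class_of y) = (x - y \in @diagonal P K).
  exact: esym (Quotient.idealrBE _ x y).
split=> [/eqP|h].
  by rewrite E => /diagonalP h i j; have := h i j; rewrite !ffunE.
by apply/eqP; rewrite E; apply/diagonalP => i j; rewrite !ffunE.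
Qed.

Lemma rep_class (x : {ffun P -> K}) i j :
  rep (class_of x) i - x i = rep (class_of x) j - x j.
Proof. by move: i j; apply/eq_class; rewrite repK. Qed.

Lemma class_of_is_zmod_morphism : zmod_morphism class_of.
Proof. by move=> x y; rewrite /class_of raddfB. Qed.

HB.instance Definition _ :=
  GRing.isZmodMorphism.Build {ffun P -> K} V class_of class_of_is_zmod_morphism.

Definition qscale (a : K) (v : V) : V := class_of [ffun i => a * rep v i].

Lemma qscale_class a (x : {ffun P -> K}) :
  qscale a (class_of x) = class_of [ffun i => a * x i].
Proof.
by apply/eq_class => i j; rewrite !ffunE -!mulrBr (rep_class x i j).
Qed.

Lemma qscaleA a b v : qscale a (qscale b v) = qscale (a * b) v.
Proof.
rewrite -[v]repK !qscale_class; congr class_of.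
by apply/ffunP => i; rewrite !ffunE mulrA.
Qed.

Lemma qscale1 : left_id 1 qscale.
Proof.
move=> v; rewrite -[v]repK qscale_class; congr class_of.
by apply/ffunP => i; rewrite !ffunE mul1r.
Qed.

Lemma qscaleDr : right_distributive qscale +%R.
Proof.
move=> a u v; rewrite -[u]repK -[v]repK -raddfD !qscale_class -raddfD.
by congr class_of; apply/ffunP => i; rewrite !ffunE mulrDr.
Qed.

Lemma qscaleDl v : {morph qscale^~ v : a b / a + b}.
Proof.
move=> a b; rewrite -[v]repK !qscale_class -raddfD.
by congr class_of; apply/ffunP => i; rewrite !ffunE mulrDl.
Qed.

HB.instance Definition _ := GRing.Zmodule_isLmodule.Build K V
  qscaleA qscale1 qscaleDr qscaleDl.

Lemma scale_class a (x : {ffun P -> K}) :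
  a *: class_of x = class_of [ffun i => a * x i].
Proof. exact: qscale_class. Qed.

End QSpace.

(* N = Z^P / Z(1,..,1), N_R = N (x) R = R^P / R(1,..,1), M = Hom(N, Z). *)
Notation latticeR P R := (qspace P R).
Notation lattice P := (qspace P int).
Notation dual_lattice P := {additive lattice P -> int}.

(* The canonical map N -> N_R. *)
Section LatticeMap.
Variables (P : finType) (R : nzRingType).

Definition lattice_map (v : lattice P) : latticeR P R :=
  class_of [ffun i => (rep v i)%:~R].

Lemma lattice_map_class (x : {ffun P -> int}) :
  lattice_map (class_of x) = class_of [ffun i => (x i)%:~R].
Proof.
by apply/eq_class => i j; rewrite !ffunE -!intrB (rep_class x i j).
Qed.

Lemma lattice_map_is_zmod_morphism : zmod_morphism lattice_map.
Proof.
move=> u v; rewrite -[u]repK -[v]repK -raddfB !lattice_map_class -raddfB.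
by congr class_of; apply/ffunP => i; rewrite !ffunE intrB.
Qed.

HB.instance Definition _ := GRing.isZmodMorphism.Build
  (lattice P) (latticeR P R) lattice_map lattice_map_is_zmod_morphism.

End LatticeMap.

(** * Cones, faces, ray generators *)

Section Cones.
Variables (P : finType) (R : realType).
Local Notation NR := (latticeR P R).

(* t is the intersection of s with a supporting hyperplane u = 0; u = 0 makes
   s a face of itself. *)
Definition face (s t : set NR) : Prop :=
  exists u : {scalar NR},
    (forall x, s x -> 0 <= u x) /\ t = [set x | s x /\ u x = 0].

Definition halfline (x : NR) : set NR := [set y | exists2 a : R, 0 <= a & y = a *: x].

(* t is a rational ray and v generates the semigroup of its lattice points. *)
Definition ray_generator (t : set NR) (v : lattice P) : Prop :=
  [/\ v != 0, t = halfline (lattice_map R v) &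
      forall w : lattice P, t (lattice_map R w) -> exists k : nat, w = v *+ k].

(* Collections of cones; the fan of an affine toric variety consists of all
   faces of its cone. *)
Definition face_fan (s : set NR) : set (set NR) := [set t | face s t].

Definition fan_ray_generator (F : set (set NR)) (v : lattice P) : Prop :=
  exists2 t, F t & ray_generator t v.

Definition constant_on_rays (F : set (set NR)) (u : dual_lattice P) (r : nat) :=
  forall v, fan_ray_generator F v -> u v = r%:Z.

Definition gorenstein_index (s : set NR) (r : nat) : Prop :=
  [/\ (0 < r)%N, exists u, constant_on_rays (face_fan s) u r &
      forall k, (0 < k)%N -> (exists u, constant_on_rays (face_fan s) u k) ->
        (r <= k)%N].

(* Crepancy of the toric map from the variety of the fan F to the affine toric
   variety of the cone s. *)
Definition crepant (s : set NR) (F : set (set NR)) : Prop :=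
  exists2 r, gorenstein_index s r &
    forall u, constant_on_rays (face_fan s) u r -> constant_on_rays F u r.

(** * Braid cones *)

(* The inequalities do not depend on the representative: see braid_cone_class. *)
Definition braid_cone (lt : rel P) : set NR :=
  [set x | forall i j, lt i j -> rep x i <= rep x j].

Lemma braid_cone_class (lt : rel P) (x : {ffun P -> R}) :
  braid_cone lt (class_of x) <-> forall i j, lt i j -> x i <= x j.
Proof.
have E i j : (rep (class_of x) i <= rep (class_of x) j) = (x i <= x j).
  have e : rep (class_of x) i - rep (class_of x) j = x i - x j.
    have /eqP := rep_class x i j; rewrite subr_eq => /eqP ->.
    by rewrite addrAC (addrAC (rep _ j)) subrr sub0r addrC.
  by rewrite -subr_le0 e subr_le0.
by split=> h i j /h; rewrite E.
Qed.

End Cones.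

(** * Posets *)

Section Posets.
Variables (d : Order.disp_t) (P : finPOrderType d).

Definition covers (x y : P) : bool :=
  (x < y)%O && [forall z : P, ~~ ((x < z)%O && (z < y)%O)].

Definition hasse_adj : rel P := fun x y => covers x y || covers y x.

Definition hasse_connected : Prop := forall x y : P, connect hasse_adj x y.

Definition bounded : Prop :=
  (exists m : P, forall x, (m <= x)%O) /\ (exists m : P, forall x, (x <= m)%O).

(* Strict total orders on the underlying set extending the strict order of P. *)
Definition linear_extension (lt : rel P) : Prop :=
  [/\ irreflexive lt, transitive lt,
      (forall x y, x != y -> lt x y || lt y x) &
      (forall x y : P, (x < y)%O -> lt x y)].

Variable R : realType.

Definition poset_cone : set (latticeR P R) := braid_cone (fun x y : P => (x < y)%O).

Definition poset_fan : set (set (latticeR P R)) :=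
  [set t | exists2 lt : rel P, linear_extension lt & face (braid_cone lt) t].

End Posets.

Arguments hasse_connected {d} P.
Arguments bounded {d} P.
Arguments poset_cone {d} P R.
Arguments poset_fan {d} P R.

(* Main.v *)
From HB Require Import structures.
Require Import Defs.
From mathcomp Require Import all_boot all_order all_algebra.
From mathcomp Require Import reals.
From mathcomp Require Import boolp classical_sets.
From mathcomp Require Import lra zify.

(** The primitive ray generators of the faces of any braid cone are indicator
    classes [1_F] of nonempty proper upper sets [F], because an integral point
    [v] of the cone splits inside the cone as [1_{v > c} + (v - 1_{v > c})].
    For a linear order every such [F] occurs, so the rays of the fan of [P] are
    the [1_F] for all nonempty proper filters [F] of [P]. If [P] is bounded then
    all of them are rays of the cone of [P] as well (each of [F] and its
    complement is connected, through the maximum and the minimum), and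
    [x_max - x_min] takes the value 1 on them. Conversely, a functional [u]
    equal to [r > 0] on all filters rules out two maximal elements [a], [b],
    since [u(1_{a,b}) = u(1_a) + u(1_b)]; dually, the complements of [a], of [b]
    and of [{a,b}] rule out two minimal elements. *)

Set Implicit Arguments.
Unset Strict Implicit.
Unset Printing Implicit Defensive.

Import Order.TTheory GRing.Theory Num.Theory.
Local Open Scope ring_scope.

(** * Coordinate differences and indicator classes *)

Section Gap.
Variables (P : finType) (K : nzRingType).

(** Differences of coordinates, unlike coordinates, descend to the quotient. They cut out the braid
    cones and, over [int], are elements of the dual lattice. *)
Definition gap (i j : P) (v : qspace P K) : K := rep v j - rep v i.

Lemma gap_class i j (x : {ffun P -> K}) : gap i j (class_of x) = x j - x i.
Proof.
rewrite /gap; have := rep_class x j i => /eqP.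
rewrite subr_eq => /eqP ->.
by rewrite addrAC (addrAC (rep _ i)) subrr sub0r addrC.
Qed.

Lemma gap_is_linear i j : scalar (gap i j).
Proof.
move=> a u v; rewrite -[u]repK -[v]repK scale_class -raddfD !gap_class !ffunE.
by rewrite mulrBr opprD addrACA.
Qed.

HB.instance Definition _ i j :=
  GRing.isLinear.Build K (qspace P K) K _ (gap i j) (gap_is_linear i j).

Lemma gap_inj (v w : qspace P K) : (forall i j, gap i j v = gap i j w) -> v = w.
Proof.
move=> h; rewrite -[v]repK -[w]repK; apply/eq_class => i j.
have := h j i; rewrite /gap => e.
rewrite -(subrK (rep v j) (rep v i)) e.
by rewrite addrAC (addrAC (rep w i)) subrr sub0r addrC.
Qed.

Definition ind (F : {set P}) : qspace P K := class_of [ffun i => (i \in F)%:R].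

Lemma gap_ind i j F : gap i j (ind F) = (j \in F)%:R - (i \in F)%:R.
Proof. by rewrite gap_class !ffunE. Qed.

End Gap.

Lemma gap_lattice_map (P : finType) (K : nzRingType) i j (v : lattice P) :
  gap i j (lattice_map K v) = (gap i j v)%:~R.
Proof. by rewrite /lattice_map gap_class !ffunE -intrB. Qed.

Lemma lattice_map_ind (P : finType) (K : nzRingType) (F : {set P}) :
  lattice_map K (ind int F) = ind K F.
Proof.
apply: gap_inj => i j; rewrite gap_lattice_map !gap_ind.
by rewrite intrB; case: (i \in F); case: (j \in F).
Qed.

(** For the strict order of a poset these are the nonempty proper filters. *)
Definition cuts (P : finType) (lt : rel P) (F : {set P}) : Prop :=
  (forall i j, lt i j -> i \in F -> j \in F) /\
  exists i j, i \notin F /\ j \in F.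

(* The blocks [F] and [~: F] are connected for [lt]. *)
Definition cut_rigid (P : finType) (lt : rel P) (F : {set P}) : Prop :=
  forall (T : Type) (x : P -> T),
    (forall i j, lt i j -> (i \in F) = (j \in F) -> x i = x j) ->
    forall i j, (i \in F) = (j \in F) -> x i = x j.

(** * Rays among the faces of a braid cone *)

Section Rays.
Variables (P : finType) (R : realType) (lt : rel P).

Lemma braid_coneE (x : latticeR P R) :
  braid_cone lt x <-> forall i j, lt i j -> 0 <= gap i j x.
Proof. by split=> h i j /h; rewrite /gap subr_ge0. Qed.

Lemma ind_braid_cone (F : {set P}) :
  (forall i j, lt i j -> i \in F -> j \in F) -> braid_cone lt (ind R F).
Proof.
move=> up; apply/braid_coneE => i j /up; rewrite gap_ind subr_ge0 ler_nat.
by case: (i \in F) => // ->.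
Qed.

(** The supporting functional is the sum of the gaps over all relations inside a block. Each gap is
    nonnegative on the cone, so a zero sum makes each vanish, and rigidity then makes the point
    constant on [F] and on its complement. *)
Lemma face_ind (F : {set P}) : cut_rigid lt F ->
    (forall i j, lt i j -> i \in F -> j \in F) ->
    (exists i j, [/\ lt i j, i \notin F & j \in F]) ->
  face (braid_cone lt) (halfline (ind R F)).
Proof.
move=> rig up [i0 [j0 [lt0 iF jF]]].
pose C (p : P * P) := lt p.1 p.2 && ((p.1 \in F) == (p.2 \in F)).
pose u (x : latticeR P R) := \sum_(p | C p) gap p.1 p.2 x.
have lin_u : scalar u.
  move=> a x y; rewrite /u mulr_sumr -big_split /=; apply: eq_bigr => p _.
  exact: linearP.
pose U := GRing.isLinear.Build R (latticeR P R) R _ u lin_u.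
pose uL : {scalar latticeR P R} := HB.pack u U.
exists uL; split=> [x /braid_coneE cx|].
  by apply: sumr_ge0 => p /andP[/cx].
apply/seteqP; split=> x /=.
  move=> [a a0 ->]; split.
    apply/braid_coneE => i j ij; rewrite linearZ /= mulr_ge0 //.
    by move/braid_coneE: (ind_braid_cone up); apply.
  apply: big1 => p /andP[_ /eqP e].
  by rewrite linearZ /= gap_ind e subrr mulr0.
move=> [/braid_coneE cx ux].
have z i j : lt i j -> (i \in F) = (j \in F) -> rep x i = rep x j.
  move=> ij e; apply/esym/eqP; rewrite -subr_eq0; apply/eqP.
  have := @psumr_eq0P _ _ C (fun p => gap p.1 p.2 x) _ ux (i, j).
  rewrite /C /gap /=; apply; last by rewrite ij e eqxx.
  by move=> p /andP[/cx].
have {}z := rig _ _ z.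
(* The relation crossing from the complement into [F] makes this coefficient nonnegative. *)
exists (gap i0 j0 x); first exact: cx.
apply: gap_inj => i j; rewrite linearZ /= gap_ind /gap.
have rx k : rep x k = if k \in F then rep x j0 else rep x i0.
  by case: ifP => kF; apply: z; rewrite kF ?jF ?(negbTE iF).
rewrite (rx i) (rx j).
by case: (i \in F); case: (j \in F); rewrite /=; lra.
Qed.

(** The gap from [i0] to [j0] is 1 on the indicator, so the real coefficient of a lattice point on
    the ray equals an integral gap. *)
Lemma ray_generator_ind (F : {set P}) i0 j0 : i0 \notin F -> j0 \in F ->
  ray_generator (halfline (ind R F)) (ind int F).
Proof.
move=> iF jF; split; last 1 first.
- move=> w [a a0 e].
  have g0 : gap i0 j0 (ind R F) = 1 by rewrite gap_ind jF (negbTE iF) subr0.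
  have ea : a = (gap i0 j0 w)%:~R.
    by rewrite -gap_lattice_map e linearZ /= g0 mulr1.
  have : 0 <= gap i0 j0 w by rewrite -(@ler0z R) -ea.
  case E : (gap i0 j0 w) => [k|//] _; exists k; apply: gap_inj => i j.
  apply: (@intr_inj R); rewrite -gap_lattice_map e ea E linearZ /= raddfMn /=.
  rewrite -lattice_map_ind gap_lattice_map -mulr_natr mulrC intrM.
  by congr (_ * _); rewrite -pmulrn natz.
- apply/eqP => e; have := gap_ind int i0 j0 F.
  by rewrite e raddf0 jF (negbTE iF).
- by rewrite lattice_map_ind.
Qed.

Lemma face_ray_generatorP v :
    fan_ray_generator (face_fan (@braid_cone P R lt)) v ->
  exists2 F, cuts lt F & v = ind int F.
Proof.
move=> [t [u [u0 tE]] [v0 tv gen]].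
have [i1 [j1 lt1]] : exists i j, rep v i < rep v j.
  apply: contrapT => h; move/eqP: v0; apply; apply: gap_inj => i j.
  rewrite raddf0 /gap; apply/eqP; rewrite subr_eq0 eq_le.
  by apply/andP; split; rewrite leNgt; apply/negP => ?; apply: h; eauto.
have tvv : t (lattice_map R v) by rewrite tv; exists 1; rewrite ?scale1r.
have [/braid_coneE cv uv] : braid_cone lt (lattice_map R v) /\ u (lattice_map R v) = 0.
  by move: tvv; rewrite tE.
have {}cv i j : lt i j -> rep v i <= rep v j.
  by move=> /cv; rewrite gap_lattice_map ler0z subr_ge0.
(* The threshold is a value of [v] that is not its maximum, so [F] is nonempty and proper. *)
pose F := [set i | rep v i1 < rep v i].
have up i j : lt i j -> i \in F -> j \in F.
  by rewrite !inE => /cv h /lt_le_trans; apply.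
have i1F : i1 \notin F by rewrite inE ltxx.
have j1F : j1 \in F by rewrite inE.
have c1 := ind_braid_cone up.
(* Integrality matters here: a relation entering [F] has gap at least 1 on [v], so subtracting 1
   keeps it nonnegative. *)
have c2 : braid_cone lt (lattice_map R (v - ind int F)).
  apply/braid_coneE => i j /cv ij.
  rewrite gap_lattice_map ler0z raddfB /= gap_ind /gap !inE.
  by case: (ltP (rep v i1) (rep v i)); case: (ltP (rep v i1) (rep v j)) => hj hi;
    rewrite ?mulr1n ?mulr0n; lia.
(* [u] is nonnegative on both summands of [v] and vanishes on [v], hence on each summand. *)
have uF : u (ind R F) = 0.
  have := u0 _ c1; have := u0 _ c2.
  rewrite raddfB /= lattice_map_ind raddfB /= uv => h1 h2.
  by apply/eqP; rewrite eq_le h2 andbT; move: h1; rewrite sub0r oppr_ge0.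
have /gen[k kE] : t (lattice_map R (ind int F)).
  by rewrite tE lattice_map_ind.
exists F; first by split=> //; exists i1, j1.
(* Here 1 is [k] times a positive integer, which forces [k = 1]. *)
have := gap_ind int i1 j1 F; rewrite kE raddfMn /= j1F (negbTE i1F) subr0.
have : 0 < gap i1 j1 v by rewrite subr_gt0.
rewrite -mulr_natr natz; case: k {kE} => [|[|k]] //= p e;
  by exfalso; nia.
Qed.

End Rays.

(** * Filters as rays of the fan and of the poset cone *)

Section Filters.
Variables (d : Order.disp_t) (P : finPOrderType d) (R : realType).
Local Notation lt_P := (fun x y : P => (x < y)%O).

Section AdaptedOrder.
Variable F : {set P}.

Let height (x : P) := #|[set y : P | (y < x)%O]|.

(** Lexicographic order: the complement of [F] before [F], then increasing [height], with ties
    broken by [enum_rank]. *)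
Let below (x y : P) : bool :=
  [|| (x \notin F) && (y \in F) |
      ((x \in F) == (y \in F)) &&
      ((height x < height y) ||
       (height x == height y) && (enum_rank x < enum_rank y))]%N.

Lemma adapted_linear_extension : (forall i j, lt_P i j -> i \in F -> j \in F) ->
  exists2 lt, linear_extension lt & forall x y, lt x y -> x \in F -> y \in F.
Proof.
move=> up; exists below; last first.
  move=> x y; rewrite /below.
  by case: (x \in F); case: (y \in F).
split.
- by move=> x; rewrite /below !ltnn !andbF; case: (x \in F).
- move=> y x z; rewrite /below.
  by case: (x \in F); case: (y \in F); case: (z \in F) => //=; lia.
- move=> x y; rewrite -(inj_eq enum_rank_inj) -val_eqE /below /=.
  by case: (x \in F); case: (y \in F) => //=; lia.
- move=> x y xy; have h : (height x < height y)%N.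
    apply: proper_card; apply/properP; split.
      by apply/fintype.subsetP => z; rewrite !inE => /lt_trans; apply.
    by exists x; rewrite !inE ?ltxx.
  by have := up _ _ xy; rewrite /below h; case: (x \in F); case: (y \in F) => // ->.
Qed.

End AdaptedOrder.

(** In a linear extension placing [F] last, elements of one block are always comparable, so rigidity
    is automatic. *)
Lemma cuts_fan_ray (F : {set P}) : cuts lt_P F -> fan_ray_generator (poset_fan P R) (ind int F).
Proof.
move=> [up [i [j [iF jF]]]].
have [lt ext upl] := adapted_linear_extension up.
have [irr tr tot _] := ext.
exists (halfline (ind R F)); last exact: ray_generator_ind iF jF.
exists lt => //; apply: face_ind => //.
- move=> T x h k l e; have [->//|kl] := eqVneq k l.
  by case/orP: (tot _ _ kl) => /h; [apply|move=> ->].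
- exists i, j; split=> //.
  have /tot/orP[//|/upl/(_ jF)] : i != j by apply: contraNneq iF => ->.
  by rewrite (negbTE iF).
Qed.

Lemma poset_fan_ray_cuts v : fan_ray_generator (poset_fan P R) v ->
  exists2 F, cuts lt_P F & v = ind int F.
Proof.
move=> [t [lt [_ _ _ ext] ft] rt].
have [|F [up ne] ->] := @face_ray_generatorP P R lt v; first by exists t.
by exists F => //; split=> // i j /ext; apply: up.
Qed.

Lemma cut_bounds (F : {set P}) (m M : P) : (forall x, (m <= x)%O) -> (forall x, (x <= M)%O) ->
  cuts lt_P F -> [/\ m \notin F, M \in F & (m < M)%O].
Proof.
move=> hm hM [up [i [j [iF jF]]]].
have le_up x y : (x <= y)%O -> x \in F -> y \in F.
  by rewrite le_eqVlt => /orP[/eqP->//|/up].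
have mF : m \notin F by apply: contra iF; apply: le_up.
have MF : M \in F by apply: le_up jF.
by split=> //; rewrite lt_neqAle hm andbT; apply: contraNneq mF => ->.
Qed.

Lemma cuts_cone_ray (F : {set P}) : bounded P -> cuts lt_P F ->
  fan_ray_generator (face_fan (poset_cone P R)) (ind int F).
Proof.
move=> [[m hm] [M hM]] cF.
have [mF MF mM] := cut_bounds hm hM cF.
exists (halfline (ind R F)); last exact: ray_generator_ind mF MF.
apply: face_ind; [|exact: cF.1|by exists m, M].
move=> T x h.
have hF k : k \in F -> x k = x M.
  move=> kF; have [->//|kM] := eqVneq k M.
  by apply: h; rewrite ?kF ?MF // lt_neqAle kM hM.
have hnF k : k \notin F -> x k = x m.
  move=> kF; have [->//|km] := eqVneq k m.
  by apply/esym/h; rewrite ?(negbTE kF) ?(negbTE mF) // lt_neqAle eq_sym km hm.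
by move=> k l; case: (boolP (l \in F)) => lF; [move/hF|move/negbT/hnF] => ->;
  rewrite ?(hF _ lF) ?(hnF _ lF).
Qed.

Lemma bounded_crepant : bounded P -> crepant (poset_cone P R) (poset_fan P R).
Proof.
move=> bP; have [[m hm] [M hM]] := bP.
(* Index 1 is trivially the least positive one. *)
exists 1%N.
  split=> //; exists (gap m M : dual_lattice P) => v /face_ray_generatorP[F cF ->].
  have [mF MF _] := cut_bounds hm hM cF.
  by rewrite /= gap_ind MF (negbTE mF) subr0.
by move=> u hu v /poset_fan_ray_cuts[F cF ->]; apply/hu/cuts_cone_ray.
Qed.

End Filters.

(** * Extremal elements and the converse *)

Section Extremal.
Variables (d : Order.disp_t) (P : finPOrderType d).

Lemma maximal_above (x : P) : exists2 a, (x <= a)%O & forall y, ~~ (a < y)%O.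
Proof.
pose up y := #|[set z : P | (y < z)%O]|.
case: (@arg_minnP _ x (fun y : P => (x <= y)%O) up (lexx x)) => a xa min.
exists a => // y; apply/negP => ay.
have := min y (le_trans xa (ltW ay)); apply/negP; rewrite -ltnNge.
apply: proper_card; apply/properP; split.
  by apply/fintype.subsetP => z; rewrite !inE; apply: lt_trans.
by exists y; rewrite !inE ?ltxx.
Qed.

Lemma minimal_below (x : P) : exists2 a, (a <= x)%O & forall y, ~~ (y < a)%O.
Proof.
pose down y := #|[set z : P | (z < y)%O]|.
case: (@arg_minnP _ x (fun y : P => (y <= x)%O) down (lexx x)) => a ax min.
exists a => // y; apply/negP => ya.
have := min y (le_trans (ltW ya) ax); apply/negP; rewrite -ltnNge.
apply: proper_card; apply/properP; split.
  by apply/fintype.subsetP => z; rewrite !inE => /lt_trans; apply.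
by exists y; rewrite !inE ?ltxx.
Qed.

Hypotheses (cardP : (2 <= #|P|)%N) (connP : hasse_connected P).

(** Connectedness enters here, through the first edge of a Hasse path to another element. *)
Lemma hasse_neighbor (x : P) : exists y : P, (x < y)%O || (y < x)%O.
Proof.
have [y yx] : exists y, y != x.
  have /card_gt1P[y [z [_ _ yz]]] := cardP.
  have [e|] := eqVneq y x; last by exists y.
  by exists z; rewrite -e eq_sym.
have /connectP[[|z p] /=] := connP x y; first by move=> _ e; rewrite e eqxx in yx.
by move=> /andP[/orP[]/andP[xz _] _] _; exists z; rewrite xz ?orbT.
Qed.

Lemma maximal_cuts (a b : P) : a != b ->
    (forall y, ~~ (a < y)%O) -> (forall y, ~~ (b < y)%O) ->
  cuts (fun x y : P => (x < y)%O) [set a] /\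
  cuts (fun x y : P => (x < y)%O) [set a; b].
Proof.
move=> ab ma mb; split; split.
- by move=> i j + /set1P ei; rewrite ei (negbTE (ma j)).
- by exists b, a; rewrite !inE eq_sym.
- by move=> i j + /set2P[] ei; rewrite ei (negbTE (ma j), negbTE (mb j)).
(* The neighbor lies below [a], so it is not the maximal element [b]; hence the pair is a proper
   subset. *)
- have [y] := hasse_neighbor a; rewrite (negbTE (ma y)) /= => ya.
  exists y, a; rewrite !inE eqxx; split=> //; apply/norP; split.
    by apply: contraTneq ya => ->; rewrite ltxx.
  by apply: contraTneq ya => ->; apply: mb.
Qed.

Lemma minimal_cuts (a b : P) : a != b ->
    (forall y, ~~ (y < a)%O) -> (forall y, ~~ (y < b)%O) ->
  cuts (fun x y : P => (x < y)%O) (~: [set a]) /\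
  cuts (fun x y : P => (x < y)%O) (~: [set a; b]).
Proof.
move=> ab ma mb; split; split.
- move=> i j + _; rewrite !inE; apply: contraTneq => ->; exact: ma.
- by exists a, b; rewrite !inE eqxx eq_sym.
- move=> i j + _; rewrite !inE; apply: contraTN => /orP[]/eqP ->; [exact: ma|exact: mb].
- have [y] := hasse_neighbor a; rewrite (negbTE (ma y)) orbF => ay.
  exists a, y; rewrite !inE eqxx; split=> //; apply/norP; split.
    by apply: contraTneq ay => ->; rewrite ltxx.
  by apply: contraTneq ay => ->; apply: mb.
Qed.

(** The two indicators add up to the all-ones vector, which is zero in the quotient. *)
Lemma ind_setC (F : {set P}) : ind int (~: F) = - ind int F.
Proof.
apply: gap_inj => i j; rewrite raddfN /= !gap_ind !inE.
by case: (i \in F); case: (j \in F).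
Qed.

Lemma ind_set2 (a b : P) : a != b ->
  ind int [set a; b] = ind int [set a] + ind int [set b].
Proof.
move=> ab; apply: gap_inj => i j; rewrite raddfD /= !gap_ind !inE.
have E k : ((k == a) || (k == b))%:R = (k == a)%:R + (k == b)%:R :> int.
  by have [->|] := eqVneq k a; rewrite ?(negbTE ab) // add0r.
by rewrite !E opprD addrACA.
Qed.

Lemma crepant_bounded (R : realType) :
  crepant (poset_cone P R) (poset_fan P R) -> bounded P.
Proof.
move=> [r [r0 [u uc] _] /(_ u uc) ur].
have {}ur F : cuts (fun x y : P => (x < y)%O) F -> u (ind int F) = r.
  by move=> cF; apply/ur/cuts_fan_ray.
have /card_gt1P[x0 [_ _]] := cardP.
split.
- have [m _ mm] := minimal_below x0; exists m => x.
  have [a ax ma] := minimal_below x.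
  have [<-//|ne] := eqVneq a m; exfalso.
  have [/ur cm _] := minimal_cuts (contra_neq esym ne) mm ma.
  have [/ur ca /ur] := minimal_cuts ne ma mm.
  (* Additivity gives [r + r = r], against [0 < r]. *)
  move: ca cm; rewrite !ind_setC ind_set2 // opprD raddfD /= => -> ->.
  by lia.
- have [m _ mm] := maximal_above x0; exists m => x.
  have [a ax ma] := maximal_above x.
  have [<-//|ne] := eqVneq a m; exfalso.
  have [/ur cm _] := maximal_cuts (contra_neq esym ne) mm ma.
  have [/ur ca /ur] := maximal_cuts ne ma mm.
  by rewrite ind_set2 // raddfD /= ca cm; lia.
Qed.

End Extremal.

Theorem theorem3p3 (R : realType) (d : Order.disp_t) (P : finPOrderType d)
    (cardP : (2 <= #|P|)%N) (connP : hasse_connected P) :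
  crepant (poset_cone P R) (poset_fan P R) <-> bounded P.
Proof. by split; [exact: crepant_bounded|exact: bounded_crepant]. Qed.
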